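(* Let $q\ge 2$, $k\ge 2$ and $w\in[q]^k$. Then $L_w$ is a conjugacy presentation of $X_{\{w\}}$; that is, the mapping from bi-infinite edge sequences (of bi-infinite walks in $L_w$) to bi-infinite label sequences is a bijection onto $X_{\{w\}}$.
   Context: $[q]=\{0,\dots,q-1\}$. $X_{\{w\}}\subset[q]^{\mathbb Z}$ is the set of bi-infinite sequences over $[q]$ that do not contain $w$ as a contiguous subword. For $w=w_1\cdots w_k\in[q]^k$, $a\in[q]$ and $1\le i\le k-1$, let $d_i(a)=\max\{j : 1\le j\le i+1,\ w_1w_2\cdots w_j = w_{i-j+2}w_{i-j+3}\cdots w_i a\}$ (the length of the longest prefix of $w$ that is a suffix of $w_1\cdots w_i a$), with $d_i(a)=*a$ (a formal symbol) if the set of such $j$ is empty. $L_w$ is the directed edge-labeled graph with vertex set $\{*a: a\in[q]\setminus\{w_1\}\}\cup\{1,2,\dots,k-1\}$ and the following edges: for each $a,b\in[q]\setminus\{w_1\}$, an edge $*a\to *b$ labeled $b$; for each $a\in[q]\setminus\{w_1\}$, an edge $*a\to 1$ labeled $w_1$; for each $a\in[q]$ and $1\le i\le k-1$, except for $a=w_k$ and $i=k-1$, an edge $i\to d_i(a)$ labeled $a$. *)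

(* Defs.v *)
From mathcomp Require Import all_boot all_order all_algebra.
From mathcomp Require Import boolp classical_sets functions.
From mathcomp Require Import zify.

Set Implicit Arguments.
Unset Strict Implicit.
Unset Printing Implicit Defensive.

Import GRing.Theory.
Local Open Scope classical_set_scope.
Local Open Scope nat_scope.

Definition occurs (A : Type) (u : seq A) (x : int -> A) : Prop :=
  exists n : int, u = [seq x (n + i%:Z)%R | i <- iota 0 (size u)].

Definition avoiding_shift (A : Type) (F : set (seq A)) : set (int -> A) :=
  [set x | forall u, F u -> ~ occurs u x].

(* The edge (v, a, v') goes from v to v' and is labeled a. *)
Record lgraph (V A : Type) := LGraph {
  vertices : set V;
  edges : set (V * A * V)
}.

Section Edges.
Variables V A : Type.
Definition src (e : V * A * V) : V := e.1.1.
Definition lab (e : V * A * V) : A := e.1.2.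
Definition tgt (e : V * A * V) : V := e.2.

Definition wf_lgraph (G : lgraph V A) : Prop :=
  forall e, edges G e -> vertices G (src e) /\ vertices G (tgt e).

Definition biinfinite_walks (G : lgraph V A) : set (int -> V * A * V) :=
  [set e | forall n, edges G (e n) /\ tgt (e n) = src (e (n + 1)%R)].

Definition label_seq (e : int -> V * A * V) : int -> A := fun n => lab (e n).

Definition conjugacy_presentation (G : lgraph V A) (X : set (int -> A)) : Prop :=
  set_bij (biinfinite_walks G) X label_seq.
End Edges.

(* [Star a] is the formal symbol *a. *)
Inductive vsym (A : Type) := Star of A | Pos of nat.
Arguments Pos {A}.

Section Lw.
Variables q k : nat.
Implicit Types (w : k.-tuple 'I_q) (a b : 'I_q) (i : nat).

(* [letter w i a] says w_i = a, with letters numbered from 1. *)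
Definition letter w i a : Prop := 0 < i /\ onth w i.-1 = Some a.

(* The maximum runs over j >= 1, so it is 0 exactly when no j qualifies. *)
Definition dmax w i a : nat :=
  \max_(1 <= j < i.+2 | suffix (take j w) (rcons (take i w) a)) j.

Definition dsym w i a : vsym 'I_q :=
  if dmax w i a == 0 then Star a else Pos (dmax w i a).

Definition Lw_vertex w (v : vsym 'I_q) : Prop :=
  match v with
  | Star a => ~ letter w 1 a
  | Pos i => 1 <= i <= k - 1
  end.

Inductive Lw_edge w : vsym 'I_q * 'I_q * vsym 'I_q -> Prop :=
| Lw_star_star a b :
    ~ letter w 1 a -> ~ letter w 1 b -> Lw_edge w (Star a, b, Star b)
| Lw_star_one a b :
    ~ letter w 1 a -> letter w 1 b -> Lw_edge w (Star a, b, Pos 1)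
| Lw_pos i a :
    1 <= i <= k - 1 -> ~ (letter w k a /\ i = k - 1) ->
    Lw_edge w (Pos i, a, dsym w i a).

Definition Lw w : lgraph (vsym 'I_q) 'I_q :=
  LGraph (Lw_vertex w) (Lw_edge w).

Lemma dmax_suffix w i a : 0 < dmax w i a ->
  dmax w i a <= i.+1 /\ suffix (take (dmax w i a) w) (rcons (take i w) a).
Proof.
rewrite /dmax big_nat_cond.
elim/big_ind: _ => // [x y Hx Hy|j /andP[/andP[_ ltj] sj] _].
  by rewrite /maxn; case: ifP.
by rewrite -ltnS.
Qed.

Lemma Lw_wf w : 2 <= k -> wf_lgraph (Lw w).
Proof.
move=> k2 e; case=> [a b Ha Hb|a b Ha Hb|i a Hi Hne]; rewrite /src /tgt /=.
- by [].
- by split=> //; lia.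
- split=> //; rewrite /dsym; case: eqP => [d0 /= [_]|].
    case: w d0 {Hne} => -[|c s] /= sz; first by move=> _.
    move=> d0 [ca]; move: d0; rewrite /dmax big_ltn_cond //= take0 ca.
    rewrite -cats1 suffix_suffix => /eqP.
    by rewrite -leqn0 geq_max.
  move=> /eqP; rewrite -lt0n /= => d_gt0.
  have [dle] := dmax_suffix d_gt0; rewrite d_gt0 /= => sfx.
  have [//|dk] := leqP (dmax w i a) (k - 1); case: Hne.
  have ik : i = k - 1 by lia.
  split=> //; split; first by lia.
  have dE : dmax w i a = k by lia.
  move: sfx; rewrite dE take_oversize ?size_tuple //.
  move=> /suffixP[s Es].
  have szs : s = [::].
    apply: size0nil; move/(congr1 size): Es.
    by rewrite size_rcons size_cat size_takel size_tuple; lia.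
  move: Es; rewrite szs cat0s => Ew.
  rewrite -Ew onthE (nth_map a) ?size_rcons ?size_takel ?size_tuple; try lia.
  rewrite nth_rcons size_takel ?size_tuple; last by lia.
  by rewrite ik subn1 ltnn eqxx.
Qed.
End Lw.

(* Main.v *)
Require Import Defs.
From mathcomp Require Import all_boot all_order all_algebra.
From mathcomp Require Import boolp classical_sets functions.
From mathcomp Require Import zify.
Local Open Scope classical_set_scope.
Local Open Scope nat_scope.

Set Implicit Arguments.
Unset Strict Implicit.
Unset Printing Implicit Defensive.

(** The graph [Lw w] is the Knuth-Morris-Pratt automaton of [w] without its
accepting state.  Its vertices are read here as pairs of a length and a letter:
[Pos i] has length [i], and [Star a] has length [0], as it records that no
nonempty prefix of [w] has just been read, and that the last letter read is [a].
With this reading all three kinds of edges obey a single rule, [Lw_edgeP]: on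
the letter [a], length [m] becomes [dmax w m a].

The point is that in a walk labeled [x] the length at time [n] has to be
[longest w x n], the length of the longest prefix of [w] that ends at position
[n] of [x].  A bi-infinite walk has no initial state, so this cannot be proved
by induction on time alone.  It is [longest_unique]: whatever the remote past, length [m]
forces the last [m] labels to spell a prefix of [w], because each step back
shortens this prefix by one letter; and reading a prefix of length [j] brings any
starting length to at least [j].  Conversely, [longest] satisfies the same recursion
wherever it stays below [k] ([longest_rec]), which is to say wherever [w] does
not occur.

So the vertices of a walk are functions of its labels: [walk_longest] gives that
the labels avoid [w] and determine the walk, and [walk_ofP] that every sequence
avoiding [w] labels the walk [walk_of w x]. *)

Section Past.
Variables (A : Type) (x : int -> A).

(** The word of length [j] that ends at position [n], position [n] included.
The recursion is on the right end, as automata read words. *)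
Fixpoint past (n : int) (j : nat) : seq A :=
  if j is j'.+1 then rcons (past (n - 1)%R j') (x n) else [::].

Lemma size_past n j : size (past n j) = j.
Proof. by elim: j n => //= j IH n; rewrite size_rcons IH. Qed.

Lemma map_iota_past n j :
  [seq x (n + i%:Z)%R | i <- iota 0 j] = past (n + j%:Z - 1)%R j.
Proof.
elim: j => // j IH.
rewrite -addn1 iotaD map_cat /= IH cats1 addn1 /=.
by congr (rcons (past _ _) (x _)); lia.
Qed.

Lemma occurs_past u : occurs u x <-> exists n, past n (size u) = u.
Proof.
split=> [[n ->]|[n un]].
  by exists (n + (size u)%:Z - 1)%R; rewrite size_map size_iota map_iota_past.
exists (n - (size u)%:Z + 1)%R.
by rewrite map_iota_past -[LHS]un; congr past; lia.
Qed.

End Past.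

Lemma suffix_past (A : eqType) (x : int -> A) n i j :
  i <= j -> suffix (past x n i) (past x n j).
Proof.
elim: i j n => [|i IH] [|j] n //= ij; first by rewrite suffix0s.
by rewrite suffix_rcons eqxx IH.
Qed.

(** Words ending at the same position are nested, so a suffix of a
past is determined by its length. *)
Lemma suffix_past_eq (A : eqType) (x : int -> A) n u j :
  size u <= j -> suffix u (past x n j) = (past x n (size u) == u).
Proof.
by move=> /(suffix_past x n); rewrite !suffixE !size_past => /eqP->.
Qed.

Section Longest.
Variables (q k : nat) (w : k.-tuple 'I_q).
Implicit Types (x : int -> 'I_q) (a : 'I_q) (n : int).

Lemma take_letterS j a : j < k ->
  letter w j.+1 a -> take j.+1 w = rcons (take j w) a.
Proof.
move=> jk [_ /=]; rewrite onthE (nth_map a) ?size_tuple // => -[<-].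
by rewrite -take_nth ?size_tuple.
Qed.

Lemma take_exS j : j < k ->
  exists2 a, letter w j.+1 a & take j.+1 w = rcons (take j w) a.
Proof.
move=> jk; pose a := tnth w (Ordinal jk).
have wa : letter w j.+1 a.
  split=> //=; rewrite onthE (nth_map a) ?size_tuple //.
  by rewrite -(tnth_nth a w (Ordinal jk)).
by exists a => //; apply: take_letterS.
Qed.

Definition reads x n j : bool := past x n j == take j w.

Lemma readsS x n j : j < k ->
  reads x n j.+1 <-> reads x (n - 1)%R j /\ letter w j.+1 (x n).
Proof.
move=> jk; rewrite /reads /=; split => [|[/eqP-> /(take_letterS jk)->]] //.
have [a wa ->] := take_exS jk.
by rewrite eqseq_rcons => /andP[-> /eqP->].
Qed.

Definition longest x n : nat := \max_(1 <= j < k.+1 | reads x n j) j.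

Lemma reads_longest x n : reads x n (longest x n).
Proof.
rewrite /longest; elim/big_ind: _ => [|i j ri rj|//].
  by rewrite /reads take0.
by rewrite /maxn; case: ifP.
Qed.

Lemma longest_le x n : longest x n <= k.
Proof.
by apply/bigmax_leqP_seq => j; rewrite mem_index_iota ltnS => /andP[].
Qed.

Lemma longest_max x n j : j <= k -> reads x n j -> j <= longest x n.
Proof.
case: j => // j jk rj; apply: (@leq_bigmax_seq _ _ _ id) => //.
by rewrite mem_index_iota.
Qed.

(** When the last [m] letters before [n] spell a prefix of [w], the finite
word [rcons (take m w) (x n)] is a window of [x]; matching prefixes of [w]
against it is the same as matching them against [x] itself. *)
Lemma dmax_reads x n m : m < k -> reads x (n - 1)%R m ->
  dmax w m (x n) = \max_(1 <= j < m.+2 | reads x n j) j.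
Proof.
move=> mk /eqP rm; rewrite /dmax big_nat_cond [RHS]big_nat_cond.
apply: eq_bigl => j; case: (boolP (0 < j < m.+2)) => //= /andP[_ jm].
have szj : size (take j w) = j by rewrite size_takel ?size_tuple; lia.
have -> : rcons (take m w) (x n) = past x n m.+1 by rewrite /= rm.
by rewrite suffix_past_eq szj.
Qed.

(** A prefix of length [j.+1] ending at [n] leaves one of length [j] ending at
[n - 1], so [longest] cannot jump by more than one and the bounded range of
[dmax] misses no candidate. *)
Lemma longest_rec x n : longest x (n - 1)%R < k ->
  longest x n = dmax w (longest x (n - 1)%R) (x n).
Proof.
move=> mk; rewrite (dmax_reads mk (reads_longest _ _)).
rewrite /longest (@big_cat_nat _ _ _ (longest x (n - 1)%R).+2) //=.
rewrite [X in maxn _ X]big_nat_cond [X in maxn _ X]big_pred0 ?maxn0 // => -[|j] //.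
apply/negP => /andP[/andP[lt_mj jk]] /readsS[|rj _]; first by lia.
by have := longest_max _ rj; lia.
Qed.

(** The lack of an initial state is overcome by induction on the length of the
prefix instead of on time.  Any prefix of [w] that is a suffix of
[take (r n) w] has really been read: its last letter is [x n], and the rest is a
suffix of [take (r (n - 1)) w].  In the other direction, reading a prefix letter
by letter keeps [r] at least as large as the part read so far. *)
Lemma longest_unique x (r : int -> nat) :
    (forall n, r n < k) -> (forall n, r n = dmax w (r (n - 1)%R) (x n)) ->
  r =1 longest x.
Proof.
move=> rk rE.
(* The reading holds for all suffixes of [take (r n) w], not just for the whole
   word: removing the last letter leaves only a suffix of the previous state. *)
have r_sfx j n : j <= k -> suffix (take j w) (take (r n) w) -> reads x n j.
  elim: j n => [|j IH] n jk; first by rewrite /reads take0.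
  move=> sj; have := size_suffix sj.
  rewrite !size_takel ?size_tuple ?(ltnW (rk _)) // => j_lt.
  have /dmax_suffix[_] : 0 < dmax w (r (n - 1)%R) (x n) by rewrite -rE; lia.
  rewrite -rE => /(suffix_trans sj); have [a wa ->] := take_exS jk.
  rewrite suffix_rcons => /andP[/eqP ax /IH rj].
  by apply/readsS => //; rewrite -ax; split=> //; apply: rj; lia.
have r_reads n : reads x n (r n) by apply: r_sfx; rewrite ?suffix_refl // ltnW.
have r_max j n : j <= k -> reads x n j -> j <= r n.
  elim: j n => // j IH n jk rj.
  have [rj' _] := (readsS x n jk).1 rj.
  rewrite rE (dmax_reads (rk _) (r_reads _)).
  apply: (@leq_bigmax_seq _ _ _ id) => //; rewrite mem_index_iota /= !ltnS.
  by apply: IH => //; lia.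
move=> n; apply/anti_leq/andP; split; first exact: longest_max (ltnW (rk n)) _.
exact: r_max (longest_le _ _) (reads_longest _ _).
Qed.

Lemma avoiding_longest x :
  avoiding_shift [set tval w] x <-> forall n, longest x n < k.
Proof.
have reads_k n : reads x n k <-> past x n (size w) = w.
  by rewrite /reads size_tuple take_oversize ?size_tuple //; split=> /eqP.
split=> [xw n|xk u ->].
  have := reads_longest x n; have := longest_le x n.
  rewrite leq_eqVlt => /orP[/eqP-> /reads_k wn|//].
  by case: (xw w erefl); apply/occurs_past; exists n.
move=> /occurs_past[n /reads_k rk].
by have := longest_max (leqnn k) rk; rewrite leqNgt xk.
Qed.

Definition rank (v : vsym 'I_q) : nat := if v is Pos i then i else 0.

Definition vertex_of (m : nat) a : vsym 'I_q :=
  if m == 0 then Star a else Pos m.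

Lemma rank_vertex_of m a : rank (vertex_of m a) = m.
Proof. by rewrite /vertex_of; case: eqP. Qed.

(** Length [0] follows the same transition rule as positive lengths. *)
Lemma dmax0 a : 0 < k -> dmax w 0 a = 1 /\ letter w 1 a \/
  dmax w 0 a = 0 /\ ~ letter w 1 a.
Proof.
move=> k0; have [b wb Eb] := take_exS k0.
rewrite /dmax big_ltn_cond // big_geq // Eb take0 suffix_rcons suffix0s.
rewrite andbT; case: eqP => [<-|ne]; [by left|right; split=> // wa].
by apply: ne; case: wa wb => _ /= wa [_ /=]; rewrite wa => -[].
Qed.

(** The forbidden edge, which would complete [w], leaves length [k - 1]; as
[2 <= k] this excludes nothing at a starred vertex. *)
Lemma Lw_edgeP v a v' : 2 <= k -> Lw_edge w (v, a, v') <->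
  [/\ Lw_vertex w v, ~ (letter w k a /\ rank v = k - 1)
    & v' = vertex_of (dmax w (rank v) a) a].
Proof.
move=> k2; have d0 b := @dmax0 b (ltnW k2); split.
  move E: (v, a, v') => e He.
  case: He E => [c b nc nb|c b nc wb|i b ik nb] [-> -> ->] //=;
    split=> //=; try lia.
  - by case: (d0 b) => -[->].
  - by case: (d0 b) => -[->].
case: v => [c|i] [/= vw na ->]; last exact: Lw_pos.
by case: (d0 a) => -[-> wa]; [apply: Lw_star_one|apply: Lw_star_star].
Qed.

(** The only possible walk labeled [x]. *)
Definition walk_of x (n : int) : vsym 'I_q * 'I_q * vsym 'I_q :=
  (vertex_of (longest x (n - 1)%R) (x (n - 1)%R), x n,
   vertex_of (longest x n) (x n)).

Lemma walk_ofP x : 2 <= k -> (forall n, longest x n < k) ->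
  biinfinite_walks (Lw w) (walk_of x).
Proof.
move=> k2 xk n; split; last first.
  by rewrite /walk_of /tgt /src /= GRing.addrK.
have rl := reads_longest x (n - 1)%R; have lk := xk (n - 1)%R.
apply/(Lw_edgeP _ _ _ k2); rewrite rank_vertex_of -longest_rec //.
move E: (longest x (n - 1)%R) rl lk => l rl lk; split=> //.
  rewrite /vertex_of; case: eqP => [l0 w1|/= l0]; last by lia.
  (* A starred vertex never carries the first letter of [w]. *)
  have /longest_max : reads x (n - 1)%R 1.
    by apply/readsS; [lia|rewrite /reads take0].
  by rewrite E l0 => /(_ (ltnW k2)).
(* The forbidden edge would make [w] occur in [x], ending at [n]. *)
case=> wk lE; have kE : k = l.+1 by lia.
have /(longest_max (leqnn k)) : reads x n k.
  rewrite [X in reads _ _ X]kE; apply/readsS; first by lia.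
  by rewrite -kE.
by rewrite leqNgt xk.
Qed.

Lemma walk_longest e : 2 <= k -> biinfinite_walks (Lw w) e ->
  (forall n, longest (label_seq e) n < k) /\ e = walk_of (label_seq e).
Proof.
move=> k2 we.
have srcE n : src (e n) = tgt (e (n - 1)%R).
  by have [_ ->] := we (n - 1)%R; rewrite GRing.subrK.
have tgtE n : tgt (e n) =
    vertex_of (dmax w (rank (tgt (e (n - 1)%R))) (label_seq e n)) (label_seq e n).
  rewrite -srcE; have [+ _] := we n; rewrite /label_seq.
  by case: (e n) => -[v a] v' /(Lw_edgeP _ _ _ k2)[].
have rk n : rank (tgt (e n)) < k.
  have [/(Lw_wf k2)[_]] := we n.
  by case: (tgt (e n)) => [a|i] /=; lia.
have rE := longest_unique rk (fun n =>
  etrans (congr1 rank (tgtE n)) (rank_vertex_of _ _)).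
split=> [n|]; first by rewrite -rE.
have tE n : tgt (e n) = vertex_of (longest (label_seq e) n) (label_seq e n).
  by rewrite -rE tgtE rank_vertex_of.
apply/funext => n; rewrite /walk_of -!tE -srcE /label_seq.
by case: (e n) => -[].
Qed.

End Longest.

Theorem fact3p3 (q k : nat) (hq : 2 <= q) (hk : 2 <= k) (w : k.-tuple 'I_q) :
  conjugacy_presentation (Lw w) (avoiding_shift [set tval w]).
Proof.
split.
- by move=> e /(walk_longest hk)[xk _]; apply/avoiding_longest.
- move=> e f; rewrite !inE => we wf ef.
  by rewrite (walk_longest hk we).2 (walk_longest hk wf).2 ef.
- move=> x /avoiding_longest xk.
  by exists (walk_of w x) => //; apply: walk_ofP.
Qed.
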